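(* Let $\pi$ be uniform on $\mathrm{PF}_n$ and $f=(f_1,\dots,f_n)$ uniform among all functions $[n]\to[n]$. For all $n\ge4$ and all $1\le k\le n$, $$\sup_{i_1,\dots,i_k\in[n]}\left|P\left(\pi_1\le i_1,\dots,\pi_k\le i_k\right)-P\left(f_1\le i_1,\dots,f_k\le i_k\right)\right|\le 2k\sqrt{\frac{\log n}{n}}+\frac{k(k-1)}{n}.$$
   Context: A parking function of length $n$ is a sequence $(\pi_1,\dots,\pi_n)$ with $1\le\pi_i\le n$ such that $\#\{t:\pi_t\le i\}\ge i$ for all $1\le i\le n$; $\mathrm{PF}_n$ denotes the set of these. $\log$ is the natural logarithm. *)

(* Defs.v *)
From mathcomp Require Import all_boot.
From Stdlib Require Import Reals.
Set Implicit Arguments. Unset Strict Implicit. Unset Printing Implicit Defensive.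

(* A sequence (pi_1,...,pi_n) with values in [n] is encoded as
   p : {ffun 'I_n -> 'I_n}, with pi_{t+1} = (p t).+1  (0-based index, 0-based value). *)

Definition is_pf (n : nat) (p : {ffun 'I_n -> 'I_n}) : bool :=
  [forall i : 'I_n, (i.+1 <= #|[set t : 'I_n | (p t).+1 <= i.+1]|)%N].

Definition PF (n : nat) : {set {ffun 'I_n -> 'I_n}} := [set p | is_pf p].

(* Event {pi_1 <= i_1, ..., pi_k <= i_k}; thresholds given by ii : nat -> nat,
   ii j = i_{j+1} (only j < k matters). *)
Definition event (n k : nat) (ii : nat -> nat) (p : {ffun 'I_n -> 'I_n}) : bool :=
  [forall t : 'I_n, (t < k)%N ==> ((p t).+1 <= ii t)%N].

Definition probPF (n k : nat) (ii : nat -> nat) : R :=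
  (INR #|[set p in PF n | event k ii p]| / INR #|PF n|)%R.

Definition probF (n k : nat) (ii : nat -> nat) : R :=
  (INR #|[set p : {ffun 'I_n -> 'I_n} | event k ii p]|
     / INR #|{ffun 'I_n -> 'I_n}|)%R.

(* Main.v *)
(* Let N_i be the number of entries of pi that are at most i, so that N_i >= i
   on PF_n. The entries pi_(m+1), ..., pi_n are exchangeable, even given the
   event {pi_1 <= i_1, ..., pi_m <= i_m}, so P(pi_(m+1) <= i | event) is a
   conditional expectation of a proportion which differs from i/n by at most
   m/n + (N_i - i)/n. As N_i - i >= 0, discarding the conditioning event
   reduces everything to a bound on E(N_i - i).
   By the cycle lemma every function [n] -> [n] has a rotation in PF_n, so PF_n
   has probability at least 1/n among all functions; the exponential moment
   bound E_f exp(l (N_i - i)) <= exp(l^2 n) with l = sqrt(ln n / n) then gives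
   E(N_i - i) <= 2 sqrt(n ln n). *)

Require Import Defs.
From mathcomp Require Import all_boot all_order all_algebra all_fingroup.
From mathcomp Require Import zify lra Rstruct.
From Stdlib Require Import Reals.
(* Loading [Reals] rebinds the key [%N]; this restores it to [nat_scope]. *)
From mathcomp Require Import ssrnat.

Set Implicit Arguments. Unset Strict Implicit. Unset Printing Implicit Defensive.
Import Order.TTheory GRing.Theory Num.Theory.

(** * Counting small entries; exchangeability of the unconstrained positions *)

Definition low (n i : nat) (p : {ffun 'I_n -> 'I_n}) : nat :=
  (\sum_(t < n) (p t < i))%N.

(** Values are 0-based, so [p t < i] says that the 1-based entry is at most [i]: [low i] is N_i, and
    [low_from m i] keeps only the positions that [event m] leaves free. *)
Definition low_from (n m i : nat) (p : {ffun 'I_n -> 'I_n}) : nat :=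
  (\sum_(t < n | m <= t) (p t < i))%N.

Section Counting.

Variable n : nat.
Implicit Types (p f : {ffun 'I_n -> 'I_n}) (i m : nat) (ii : nat -> nat).

Lemma card_lt_ord i : i <= n -> \sum_(v < n) (v < i) = i.
Proof.
move=> lein; rewrite -{2}(card_ord i) -sum1_card (big_ord_widen n (fun=> 1) lein).
by rewrite [RHS]big_mkcond; apply: eq_bigr => v _; case: ltnP.
Qed.

Lemma card_geq_ord m : m <= n -> \sum_(t < n | m <= t) 1 = n - m.
Proof.
move=> lemn; apply/eqP; rewrite -(eqn_add2l m) subnKC // -{1}(card_lt_ord lemn).
rewrite [X in _ + X]big_mkcond -big_split /=; apply/eqP.
transitivity (\sum_(t < n) 1); last by rewrite sum1_card card_ord.
by apply: eq_bigr => t _; case: ltnP.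
Qed.

Lemma in_PF p : (p \in PF n) = [forall i : 'I_n, i < low i.+1 p].
Proof.
by rewrite inE; apply: eq_forallb => i; rewrite -sum1dep_card big_mkcond.
Qed.

Lemma low_PF p i : p \in PF n -> i <= n -> i <= low i p.
Proof. by rewrite in_PF; case: i => // i /forallP pfp lti; apply: (pfp (Ordinal lti)). Qed.

Lemma eventS p m ii (ltmn : m < n) :
  event m.+1 ii p = event m ii p && (p (Ordinal ltmn) < ii m).
Proof.
apply/forallP/andP => [ev | [/forallP ev pm] t].
  split; last by have /implyP := ev (Ordinal ltmn); apply.
  by apply/forallP => t; apply/implyP => /ltnW; apply/implyP: (ev t).
apply/implyP; rewrite ltnS leq_eqVlt => /predU1P[tm | ltm].
  by have -> : t = Ordinal ltmn by [apply: val_inj]; rewrite /= -?tm in pm *.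
exact: (implyP (ev t)).
Qed.

(* Positions [m] and [s] may be swapped: neither is constrained by [event m]. *)
Lemma exchangeable m ii i (ltmn : m < n) (s : 'I_n) : m <= s ->
  \sum_(p in PF n | event m ii p) (p s < i)
    = \sum_(p in PF n | event m ii p) (p (Ordinal ltmn) < i).
Proof.
move=> lems; pose sigma := tperm (Ordinal ltmn) s.
pose h (p : {ffun 'I_n -> 'I_n}) : {ffun 'I_n -> 'I_n} := [ffun t => p (sigma t)].
have hK : involutive h by move=> p; apply/ffunP => t; rewrite !ffunE tpermK.
rewrite (reindex_inj (inv_inj hK)) /=; apply: eq_big => [p | p _].
  congr (_ && _).
    rewrite !in_PF; apply: eq_forallb => j; congr (_ < _).
    rewrite /low [RHS](reindex_inj (@perm_inj _ sigma)) /=.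
    by apply: eq_bigr => t _; rewrite ffunE.
  apply: eq_forallb => t; case: ltnP => //= lttm.
  by rewrite ffunE tpermD // -val_eqE /= neq_ltn ?lttm ?(leq_trans lttm lems) orbT.
by rewrite ffunE /sigma tpermR.
Qed.

(** By exchangeability, each of the [n - m] free positions holds a value below [ii m] as often as
    position [m] does; summing over these positions gives the right-hand side. *)
Lemma card_eventS m ii (ltmn : m < n) :
  (n - m) * #|[set p in PF n | event m.+1 ii p]|
    = \sum_(p in PF n | event m ii p) low_from m (ii m) p.
Proof.
rewrite -(card_geq_ord (ltnW ltmn)) sum1_card -sum1dep_card -sum_nat_const.
rewrite [RHS]exchange_big; apply: eq_bigr => s lems /=.
rewrite (exchangeable _ _ ltmn lems) [RHS]big_mkcond [LHS]big_mkcond.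
apply: eq_bigr => p _; rewrite (eventS p ii ltmn).
by case: (p \in _) => //=; case: event => //=; case: ltnP.
Qed.

Lemma low_from_le p m i : low_from m i p <= low i p.
Proof. by rewrite /low (bigID (fun t : 'I_n => m <= t)) leq_addr. Qed.

Lemma low_from_max p m i : m <= n -> low_from m i p <= n - m.
Proof.
by move=> lemn; rewrite -card_geq_ord //; apply: leq_sum => t _; case: (_ < _).
Qed.

Lemma low_low_from p m i : m <= n -> low i p <= low_from m i p + m.
Proof.
move=> lemn; rewrite /low (bigID (fun t : 'I_n => m <= t)) leq_add2l /=.
rewrite -[X in _ <= X](card_lt_ord lemn) big_mkcond; apply: leq_sum => t _.
by rewrite -ltnNge; do 2 case: (_ < _).
Qed.

Lemma card_event_fun m ii : (forall j, j < m -> ii j <= n) ->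
  #|[set p : {ffun 'I_n -> 'I_n} | event m ii p]|
    = \prod_(t < n) (if t < m then ii t else n).
Proof.
move=> iin; pose Q (t v : 'I_n) := (t < m) ==> (v < ii t).
rewrite -sum1dep_card; under [RHS]eq_bigr => t _.
  have -> : (if t < m then ii t else n) = \sum_(v | Q t v) 1; last by over.
  rewrite /Q; case: ltnP => [/iin le|_] /=.
    by rewrite -{1}(card_lt_ord le) [RHS]big_mkcond; apply: eq_bigr => v _; case: ltnP.
  by rewrite sum1_card card_ord.
rewrite bigA_distr_big_dep /=.
by apply: eq_big => [p | p _]; [apply/forallP/familyP | rewrite big1].
Qed.

End Counting.

(** * Rotations and the cycle lemma *)

Local Open Scope ring_scope.

(** The shift is modulo the length itself, so an orbit may contain several parking functions; one
    per orbit is enough for a lower bound on their number. *)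
Definition rotate (n : nat) (r : 'I_n.+1) (f : {ffun 'I_n.+1 -> 'I_n.+1}) :
  {ffun 'I_n.+1 -> 'I_n.+1} := [ffun t => f t - r].

Lemma rotateK (n : nat) (r : 'I_n.+1) : cancel (rotate r) (rotate (- r)).
Proof. by move=> f; apply/ffunP => t; rewrite !ffunE opprK subrK. Qed.

Local Close Scope ring_scope.

Lemma val_rotate (n : nat) (r : 'I_n.+1) (f : {ffun 'I_n.+1 -> 'I_n.+1}) t :
  rotate r f t = (if r <= f t then f t - r else f t + n.+1 - r) :> nat.
Proof.
have -> : val (rotate r f t) = (f t + (n.+1 - r) %% n.+1) %% n.+1 by rewrite ffunE.
have ltf := ltn_ord (f t); have ltr := ltn_ord r.
case: leqP => lerf; rewrite modnDmr.
  have -> : f t + (n.+1 - r) = (f t - r) + n.+1 by lia.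
  by rewrite modnDr modn_small //; lia.
by rewrite modn_small //; lia.
Qed.

(* The cycle lemma: rotate the values so that the minimum of [low j f - j] sits at 0. *)
Lemma rotate_PF (n : nat) (f : {ffun 'I_n.+1 -> 'I_n.+1}) :
  exists r : 'I_n.+1, rotate r f \in PF n.+1.
Proof.
(* Adding [n.+1 - j] stands for subtracting [j], without truncation in [nat]. *)
have [r rmin] : exists r : 'I_n.+1, forall j : 'I_n.+1,
    low r f + (n.+1 - r) <= low j f + (n.+1 - j).
  have [r _ rmin] := @arg_minnP _ ord0 predT (fun r : 'I_n.+1 => low r f + (n.+1 - r)) isT.
  by exists r => j; apply: rmin.
have lowN : low n.+1 f = n.+1.
  rewrite /low -[RHS](card_ord n.+1) -sum1_card.
  by apply: eq_bigr => t _; rewrite ltn_ord.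
(* Minimality extends to [j = n.+1], where [low j f - j] is 0, as at [j = 0]. *)
have lowr j : j <= n.+1 -> low r f + j <= low j f + r.
  rewrite leq_eqVlt => /predU1P[-> | ltjN].
    have := rmin ord0; have -> : low (@ord0 n) f = 0 by rewrite /low big1.
    by rewrite lowN /= subn0; have := ltn_ord r; lia.
  by have /= := rmin (Ordinal ltjN); have := ltn_ord r; lia.
exists r; rewrite in_PF; apply/forallP => -[i ltiN]; rewrite [val _]/=.
(* The [i.+1] cyclically consecutive values from [r] on either form one interval or wrap around past
   [n]. *)
case: (leqP (r + i.+1) n.+1) => [le | gt].
  have := lowr _ le; suff : low (r + i.+1) f <= low r f + low i.+1 (rotate r f) by lia.
  rewrite /low -big_split /=; apply: leq_sum => t _; rewrite val_rotate.
  by have := ltn_ord (f t); case: (leqP r (f t)) => ?; lia.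
have /lowr : r + i.+1 - n.+1 <= n.+1 by have := ltn_ord r; lia.
suff : n.+1 + low (r + i.+1 - n.+1) f <= low r f + low i.+1 (rotate r f).
  by have := ltn_ord r; lia.
rewrite -{1}(card_ord n.+1) -sum1_card /low -!big_split /=.
apply: leq_sum => t _; rewrite val_rotate.
by have := ltn_ord (f t); have := ltn_ord r; case: (leqP r (f t)) => ?; lia.
Qed.

(** Rotating back, the [n] rotations of the elements of [PF n] cover all functions. *)
Lemma card_PF_ge (n : nat) : 0 < n -> n ^ n <= n * #|PF n|.
Proof.
case: n => // n _.
pose g (x : 'I_n.+1 * {ffun 'I_n.+1 -> 'I_n.+1}) := rotate x.1 x.2.
have <- : #|{ffun 'I_n.+1 -> 'I_n.+1}| = n.+1 ^ n.+1 by rewrite card_ffun card_ord.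
have <- : #|setX [set: 'I_n.+1] (PF n.+1)| = n.+1 * #|PF n.+1|.
  by rewrite cardsX cardsT card_ord.
rewrite -cardsT; apply: leq_trans (leq_imset_card g _).
apply/subset_leq_card/subsetP => f _; have [r rPF] := rotate_PF f.
apply/imsetP; exists (GRing.opp r, rotate r f); last by rewrite /g /= rotateK.
by apply/setXP; rewrite inE.
Qed.

(** * Exponential moments and the mean of N_i *)

Section Analysis.

Local Open Scope ring_scope.
Arguments exp _%_ring_scope.
Arguments ln _%_ring_scope.
Arguments sqrt _%_ring_scope.

Lemma exp_ge1D (x : R) : 1 + x <= exp x.
Proof. exact/RleP/exp_ineq1_le. Qed.

Lemma exp_gt0 (x : R) : 0 < exp x.
Proof. exact/RltP/exp_pos. Qed.

Lemma exp_add (x y : R) : exp (x + y) = exp x * exp y.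
Proof. exact: exp_plus. Qed.

Lemma exp_sum (I : Type) (r : seq I) (F : I -> R) :
  exp (\sum_(i <- r) F i) = \prod_(i <- r) exp (F i).
Proof. by apply: big_morph => [x y|]; rewrite ?exp_add // expR0. Qed.

(** Follows from exp(-x) >= 1 - x, because (1 + x + 4x^2)(1 - x) = 1 + x^2 (3 - 4x) >= 1. *)
Lemma exp_le_quadratic (x : R) : x <= 3 / 4 -> exp x <= 1 + x + 4 * x ^+ 2.
Proof.
move=> xle; have := exp_ge1D (- x).
have expK : exp x * exp (- x) = 1 by rewrite -exp_add subrr expR0.
have e0 := exp_gt0 x; rewrite -(ler_pM2l e0) expK => le1.
have x2 : 0 <= x ^+ 2 * (3 - 4 * x) by rewrite mulr_ge0 ?sqr_ge0 //; lra.
rewrite -(@ler_pM2r _ (1 - x)); last by lra.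
apply: le_trans le1 _; move: x2; clear; lra.
Qed.

(** Coordinates are independent, so the sum is the [n]-th power of a one-coordinate sum; a centred
    indicator has variance at most 1/4, which absorbs the 4 of [exp_le_quadratic]. *)
Lemma mgf_low (n i : nat) (l : R) : (i <= n)%N -> 0 <= l <= 3 / 4 ->
  \sum_(f : {ffun 'I_n -> 'I_n}) exp (l * ((low i f)%:R - i%:R))
    <= n%:R ^+ n * exp (l ^+ 2 * n%:R).
Proof.
move=> lein /andP[l0 l1]; have [n0 | n_gt0] := posnP n.
  move: i lein; rewrite n0 => i; rewrite leqn0 => /eqP ->.
  rewrite (eq_bigr (fun=> 1)) => [|f _]; last first.
    by rewrite /low big_ord0 subrr mulr0 expR0.
  by rewrite sumr_const card_ffun card_ord expn0 expr0 mulr0 expR0 mul1r.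
have N0 : (0 : R) < n%:R by rewrite ltr0n.
pose q : R := i%:R / n%:R.
have qN : q * n%:R = i%:R by rewrite divfK ?gt_eqF.
have q0 : 0 <= q by rewrite divr_ge0 ?ler0n.
have q1 : q <= 1 by rewrite ler_pdivrMr // mul1r ler_nat.
pose X (v : 'I_n) : R := (v < i)%N%:R - q.
have lowE (f : {ffun 'I_n -> 'I_n}) : (low i f)%:R - i%:R = \sum_t X (f t).
  by rewrite sumrB sumr_const card_ord -[q *+ _]mulr_natr qN natr_sum.
under eq_bigr => f _ do rewrite lowE mulr_sumr exp_sum.
rewrite -(bigA_distr_bigA (fun _ : 'I_n => fun v => exp (l * X v))) /=.
rewrite prodr_const card_ord.
have -> : exp (l ^+ 2 * n%:R) = exp (l ^+ 2) ^+ n by rewrite expRX mulr_natr.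
rewrite -exprMn; apply: lerXn2r; rewrite ?nnegrE.
- by apply: sumr_ge0 => v _; apply/ltW/exp_gt0.
- by rewrite mulr_ge0 ?ltW ?exp_gt0.
have sumX : \sum_v X v = 0.
  by rewrite sumrB sumr_const card_ord -[q *+ _]mulr_natr qN -natr_sum card_lt_ord ?subrr.
have sumX2 : \sum_v X v ^+ 2 = n%:R * (q * (1 - q)).
  (* An indicator equals its square, so [X v ^+ 2] is affine in [X v]. *)
  rewrite (eq_bigr (fun v => (1 - 2 * q) * X v + q * (1 - q))) => [|v _].
    by rewrite big_split /= -mulr_sumr sumX sumr_const card_ord -mulr_natr; lra.
  by rewrite /X; case: (_ < _)%N => /=; lra.
apply: (@le_trans _ _ (n%:R * (1 + l ^+ 2))); last first.
  by rewrite ler_pM2l // exp_ge1D.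
apply: (@le_trans _ _ (\sum_v (1 + l * X v + 4 * l ^+ 2 * X v ^+ 2))).
  apply: ler_sum => v _; rewrite -mulrA -exprMn exp_le_quadratic //.
  suff : X v <= 1 by nra.
  by rewrite /X; case: (_ < _)%N => /=; lra.
rewrite !big_split /= sumr_const card_ord -!mulr_sumr sumX sumX2.
have : q * (1 - q) <= 1 / 4 by have := sqr_ge0 (q - 1 / 2); lra.
have := sqr_ge0 l; rewrite -mulr_natr; move: (q * _) (l ^+ 2) => a b b0 a4.
have : n%:R * (b * (1 - 4 * a)) >= 0 by rewrite !mulr_ge0 //; lra.
by nra.
Qed.

(** The tangent bound ln y <= y - 1 is used at y = x/2 and at y = 2. The result keeps sqrt(ln n / n)
    in the range allowed by [mgf_low]. *)
Lemma ln_le_half (x : R) : 0 < x -> ln x <= x / 2.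
Proof.
move=> x0; have y0 : 0 < x / 2 by lra.
have lny (y : R) : 0 < y -> ln y <= y - 1.
  move=> yp; have := exp_ge1D (ln y); rewrite exp_ln; last exact/RltP.
  by lra.
have -> : ln x = ln (x / 2) + ln 2.
  by have := ln_mult _ _ (RltP y0) (RltP (ltr0Sn R 1)); rewrite RmultE divfK ?pnatr_eq0.
by have := lny _ y0; have := lny 2 (ltr0Sn _ 1); lra.
Qed.

(* Markov's inequality in exponential form: on [PF n] the law is absolutely
   continuous with density at most [n] with respect to the uniform law. *)
Lemma mean_low (n i : nat) : (2 <= n)%N -> (i <= n)%N ->
  \sum_(p in PF n) ((low i p)%:R - i%:R)
    <= 2 * n%:R * sqrt (ln n%:R / n%:R) * #|PF n|%:R.
Proof.
move=> n2 lein; have n_gt0 : (0 < n)%N by apply: leq_trans n2.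
have N0 : (0 : R) < n%:R by rewrite ltr0n.
have ln0 : 0 < ln n%:R.
  apply/RltP; have := ln_increasing 1 n%:R Rlt_0_1; rewrite ln_1; apply.
  by apply/RltP; rewrite ltr1n.
rewrite RsqrtE; set l := Num.sqrt _.
have l2 : l ^+ 2 * n%:R = ln n%:R.
  by rewrite sqr_sqrtr ?divfK ?gt_eqF // divr_ge0 // ltW.
have l0 : 0 < l by rewrite sqrtr_gt0 divr_gt0.
have l1 : l <= 3 / 4.
  have : ln n%:R <= n%:R / 2 :> R by apply: ln_le_half.
  by rewrite -l2 => le; have : l ^+ 2 <= 1 / 2 by [rewrite -(ler_pM2r N0); lra]; nra.
(* One [ln n] pays for the density bound [n], the other is [l ^+ 2 * n]. *)
pose c := 2 * ln n%:R.
have expc : n%:R * exp (l ^+ 2 * n%:R) = exp c :> R.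
  by rewrite l2 /c -[2]/(1 + 1) mulrDl mul1r exp_add exp_ln //; apply/RltP.
have up : \sum_(p in PF n) exp (l * ((low i p)%:R - i%:R)) <= #|PF n|%:R * exp c.
  apply: le_trans (_ : n%:R ^+ n * exp (l ^+ 2 * n%:R) <= _).
    apply: le_trans (mgf_low lein _); last by rewrite (ltW l0).
    rewrite [leRHS](bigID (mem (PF n))) /= lerDl.
    by apply: sumr_ge0 => p _; apply/ltW/exp_gt0.
  rewrite -expc mulrA ler_pM2r ?exp_gt0 // -natrX -natrM ler_nat mulnC.
  exact: card_PF_ge.
(* The tangent line of exp at [c] does the work of Jensen's inequality: the mean of l (N_i - i) is
   at most [c], and c / l = 2 n l. *)
have low_up : \sum_(p in PF n) exp c * (1 + l * ((low i p)%:R - i%:R) - c) <=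
    \sum_(p in PF n) exp (l * ((low i p)%:R - i%:R)).
  apply: ler_sum => p _; rewrite -{2}[l * _](subrK c) exp_add mulrC.
  by rewrite ler_pM2r ?exp_gt0 // -addrA exp_ge1D.
have := le_trans low_up up; rewrite -mulr_sumr mulrC ler_pM2r ?exp_gt0 //.
set S := (X in _ -> X <= _); rewrite 2!big_split /= !sumr_const -mulr_sumr -/S => le.
rewrite -(ler_pM2l l0); move: le; rewrite -[(- c) *+ _]mulr_natr /c -l2.
lra.
Qed.

(** * One-step recursions for both probabilities, and their comparison *)

Lemma low_from_dist (n m i : nat) (p : {ffun 'I_n -> 'I_n}) :
    p \in PF n -> (m <= n)%N -> (i <= n)%N ->
  `|n%:R * (low_from m i p)%:R - (n - m)%:R * i%:R|
    <= (n - m)%:R * (m%:R + ((low i p)%:R - i%:R)) :> R.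
Proof.
move=> pPF lemn lein; have := low_PF pPF lein; have := low_from_le p m i.
have := low_from_max p i lemn; have := low_low_from p i lemn.
rewrite -[n in n%:R](subnK lemn) natrD.
move: (n - m)%N (low_from _ _ _) (low _ _) => d x y.
rewrite -(ler_nat R) natrD -!(ler_nat R) => le1 le2 le3 le4.
have d0 := ler0n R d; have m0 := ler0n R m; have x0 := ler0n R x.
(* With n = d + m, the lower bound uses i <= y <= x + m, the upper one x <= y and x <= d. *)
rewrite ler_norml; apply/andP; split; first by nra.
by nra.
Qed.

Lemma probPFS (n m : nat) (ii : nat -> nat) :
    (2 <= n)%N -> (m < n)%N -> (ii m <= n)%N ->
  `|n%:R * probPF n m.+1 ii - (ii m)%:R * probPF n m ii|
    <= m%:R + 2 * n%:R * sqrt (ln n%:R / n%:R).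
Proof.
move=> n2 ltmn lein; have n_gt0 : (0 < n)%N by apply: leq_trans n2.
have P0 : (0 : R) < #|PF n|%:R.
  rewrite ltr0n; have := card_PF_ge n_gt0; case: posnP => // ->.
  by rewrite muln0 leqn0 expn_eq0 gtn_eqF.
have d0 : (0 : R) < (n - m)%:R by rewrite ltr0n subn_gt0.
rewrite /probPF !RdivE !INRE !mulrA -mulrBl normrM normfV (gtr0_norm P0).
rewrite ler_pdivrMr // -(ler_pM2l d0) -{1}(gtr0_norm d0) -normrM mulrBr !mulrA.
rewrite [(n - m)%:R * n%:R]mulrC -[n%:R * _ * _]mulrA.
have := congr1 (fun c => c%:R : R) (card_eventS ii ltmn); rewrite natrM => ->.
rewrite -[#|[set p in PF n | event m ii p]|]sum1dep_card !natr_sum !mulr_sumr -sumrB.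
apply: le_trans (ler_norm_sum _ _ _) _.
apply: le_trans (_ : _ <= \sum_(p in PF n)
  (n - m)%:R * (m%:R + ((low (ii m) p)%:R - (ii m)%:R))) _.
  (* The bound is nonnegative on [PF n], so the sum over the event may be enlarged to all of
     [PF n]. *)
  rewrite [leRHS](bigID (event m ii)) /= -[leLHS]addr0; apply: lerD.
    apply: ler_sum => p /andP[pPF _]; rewrite mulr1.
    exact: low_from_dist (ltnW ltmn) lein.
  apply: sumr_ge0 => p /andP[pPF _]; rewrite mulr_ge0 ?ler0n // addr_ge0 ?ler0n //.
  by rewrite subr_ge0 ler_nat low_PF.
rewrite -mulr_sumr -[leRHS]mulrA ler_pM2l // big_split /= sumr_const.
rewrite -[m%:R *+ _]mulr_natr mulrDl lerD2l.
exact: mean_low.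
Qed.

(** Independence of the coordinates makes the recursion exact here. *)
Lemma probFS (n m : nat) (ii : nat -> nat) :
    (m < n)%N -> (forall j, (j <= m)%N -> (ii j <= n)%N) ->
  n%:R * probF n m.+1 ii = (ii m)%:R * probF n m ii.
Proof.
move=> ltmn iin; rewrite /probF !RdivE !INRE !mulrA -!natrM.
rewrite !card_event_fun => [|j /ltnW /iin // | //].
congr (_%:R / _); rewrite (bigD1 (Ordinal ltmn)) // [in RHS](bigD1 (Ordinal ltmn)) //=.
rewrite ltnS leqnn ltnn mulnCA; congr (_ * (_ * _))%N.
apply: eq_bigr => t; rewrite -val_eqE /= => tm.
by rewrite ltnS leq_eqVlt (negPf tm).
Qed.

(** Induction on [m]: as ii m <= n, the earlier error is passed on with a factor at most 1, and the
    step adds m/n + 2 sqrt(ln n / n); the quadratic term suffices since m(m - 1) + m <= (m + 1)m. *)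
Lemma probPF_probF_dist (n m : nat) (ii : nat -> nat) :
    (2 <= n)%N -> (m <= n)%N -> (forall j, (j < m)%N -> (ii j <= n)%N) ->
  `|probPF n m ii - probF n m ii|
    <= 2 * m%:R * sqrt (ln n%:R / n%:R) + m%:R * (m%:R - 1) / n%:R.
Proof.
move=> n2; have n_gt0 : (0 < n)%N by apply: leq_trans n2.
have N0 : (0 : R) < n%:R by rewrite ltr0n.
set s := sqrt _; elim: m => [_ _ | m IH ltmn iin].
  have event0 p : event 0 ii p by apply/forallP.
  have P0 : #|PF n|%:R != 0 :> R.
    rewrite pnatr_eq0; have := card_PF_ge n_gt0; case: eqP => // ->.
    by rewrite muln0 leqn0 expn_eq0 gtn_eqF.
  have F0 : #|{ffun 'I_n -> 'I_n}|%:R != 0 :> R.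
    by rewrite card_ffun card_ord pnatr_eq0 expn_eq0 gtn_eqF.
  have -> : probPF n 0 ii = 1.
    rewrite /probPF RdivE !INRE -[RHS](divff P0); congr (_%:R / _).
    by apply: eq_card => p; rewrite inE event0 andbT.
  have -> : probF n 0 ii = 1.
    rewrite /probF RdivE !INRE -[RHS](divff F0); congr (_%:R / _).
    by apply: eq_card => p; rewrite inE event0.
  by rewrite subrr normr0 mulr0 !mul0r addr0.
have lein := iin m (leqnn _).
have := IH (ltnW ltmn) (fun j ltjm => iin j (leqW ltjm)).
have := probPFS n2 ltmn lein; have := probFS ltmn iin.
rewrite -/s; move: (probPF _ _ _) (probPF _ _ _) (probF _ _ _) (probF _ _ _).
move=> b a y x ax step dist; rewrite -(ler_pM2l N0) -{1}(gtr0_norm N0) -normrM.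
have -> : n%:R * (a - x) = (n%:R * a - (ii m)%:R * b) + (ii m)%:R * (b - y).
  by rewrite !mulrBr ax addrA subrK.
apply: le_trans (ler_normD _ _) _; apply: le_trans (lerD step (lexx _)) _.
rewrite normrM ger0_norm ?ler0n //.
apply: le_trans (lerD (lexx _) (_ : _ <= n%:R * `|b - y|)) _.
  by rewrite ler_wpM2r ?ler_nat.
move: dist; rewrite -(ler_pM2l N0) !mulrDr ![n%:R * (_ / _)]mulrC !divfK ?gt_eqF //.
rewrite -[m.+1]addn1 natrD; have := ler0n R m.
by lra.
Qed.

End Analysis.

Theorem theorem3 (n k : nat) (ii : nat -> nat) :
  (4 <= n)%N -> (1 <= k)%N -> (k <= n)%N ->
  (forall j : nat, (j < k)%N -> (1 <= ii j)%N /\ (ii j <= n)%N) ->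
  (Rabs (probPF n k ii - probF n k ii)
   <= 2 * INR k * sqrt (ln (INR n) / INR n) + INR k * (INR k - 1) / INR n)%R.
Proof.
move=> n4 _ lekn iin; apply/RleP; rewrite !INRE.
by apply: probPF_probF_dist (leq_trans _ n4) lekn _ => // j /iin[].
Qed.
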